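(* Let $X$ be a Banach space. (a) Suppose that, for a point $x\in B_X$, either $x$ is an extreme point of $B_X$ or $\|x\|<1$. Then $x$ has property (co). (b) Suppose that $X$ is strictly convex. Then $X$ has property (co).
   Context: Banach spaces are over the scalar field $\mathbb K$, where $\mathbb K=\mathbb R$ or $\mathbb K=\mathbb C$. $B_X$ denotes the closed unit ball of $X$, and $B(x,\delta)=\{y\in X:\|y-x\|<\delta\}$. A point $x\in B_X$ has property (co) if for every $n\in\mathbb N$, $n\ge2$, the following holds: whenever $x_1,\dots,x_n\in B_X$ and $\lambda_1,\dots,\lambda_n>0$, $\sum_{j=1}^n\lambda_j=1$, are such that $x=\sum_{j=1}^n\lambda_jx_j$, and $\varepsilon>0$, there is a $\delta>0$ such that, setting $B:=B(x,\delta)\cap B_X$, there are (norm-)continuous functions $\widehat v_j:B\to B_X$, $j\in\{1,\dots,n\}$, such that for every $u\in B$ one has $u=\sum_{j=1}^n\lambda_j\widehat v_j(u)$ and $\|\widehat v_j(u)-x_j\|<\varepsilon$ for every $j\in\{1,\dots,n\}$. The space $X$ has property (co) if every point $x\in B_X$ has property (co). *)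

(* Defs.v *)
From HB Require Import structures.
From mathcomp Require Import all_boot all_order all_algebra.
From mathcomp Require Import complex.
From mathcomp Require Import all_classical all_reals all_analysis.
Import Order.TTheory GRing.Theory Num.Theory.
Import numFieldNormedType.Exports.

Set Implicit Arguments.
Unset Strict Implicit.
Unset Printing Implicit Defensive.

Local Open Scope classical_set_scope.
Local Open Scope ring_scope.

(* On R[i] the order is [z <= w] iff [w - z] is a nonnegative real, and the norm
   of an R[i]-normed module takes its values in R[i].  Hence over both scalar
   fields [0 < e] says that the scalar e is a positive real number. *)
Variant real_or_complex (R : realType) : numFieldType -> Prop :=
  | RealScalars : real_or_complex R (R : numFieldType)
  | ComplexScalars : real_or_complex R (R[i]%C : numFieldType).

Definition unit_ball (K : numFieldType) (X : normedModType K) : set X :=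
  [set x | `|x| <= 1].

Definition extreme_point (K : numFieldType) (X : normedModType K) (A : set X)
    (x : X) : Prop :=
  A x /\
  forall (y z : X) (t : K), A y -> A z -> 0 < t -> t < 1 ->
    x = t *: y + (1 - t) *: z -> y = x /\ z = x.

Definition strictly_convex (K : numFieldType) (X : normedModType K) : Prop :=
  forall x y : X, `|x| = 1 -> `|y| = 1 -> x <> y -> `|2^-1 *: (x + y)| < 1.

Definition has_co_at (K : numFieldType) (X : normedModType K) (x : X) : Prop :=
  forall (n : nat) (xs : 'I_n -> X) (lam : 'I_n -> K),
    (2 <= n)%N ->
    (forall j, unit_ball (xs j)) ->
    (forall j, 0 < lam j) ->
    \sum_(j < n) lam j = 1 ->
    x = \sum_(j < n) lam j *: xs j ->
    forall e : K, 0 < e ->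
    exists2 d : K, 0 < d &
      let B := ball x d `&` @unit_ball K X in
      exists v : 'I_n -> X -> X,
        (forall j, {within B, continuous (v j)}) /\
        forall u, B u ->
          u = \sum_(j < n) lam j *: v j u /\
          forall j, unit_ball (v j u) /\ `|v j u - xs j| < e.

Definition has_co (K : numFieldType) (X : normedModType K) : Prop :=
  forall x : X, unit_ball x -> has_co_at x.

(* Main.v *)
Require Import Defs.
From mathcomp Require Import all_boot all_order all_algebra.
From mathcomp Require Import complex.
From mathcomp Require Import all_classical all_reals all_analysis.
Import Order.TTheory GRing.Theory Num.Theory.
Import numFieldNormedType.Exports.
Local Open Scope ring_scope.

(** Write x = \sum_j lam_j x_j with all the x_j in the unit ball.  In two cases
    the nearby points u can be decomposed by explicit formulas.

    If x is extreme, isolating one summand x_j and normalising the sum of the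
    others exhibits x as a proper convex combination of x_j and a point of the
    ball, so every x_j equals x ([extreme_point_comb]); then v_j(u) = u works.

    If |x| < 1, shrink the x_j slightly towards x, to (1 - t) x_j + t x.  This
    keeps the barycentre x and brings all the points into the ball of radius
    1 - t (1 - |x|) < 1, which leaves room for translating each of them by u - x
    as long as |u - x| <= t (1 - |x|) ([has_co_at_interior]).

    In a strictly convex space every unit vector is extreme
    ([strictly_convex_extreme]), so these two cases cover the whole ball.

    The scalars are compared in an arbitrary [numFieldType], whose order is only
    partial: the proofs compare nothing but real elements, which treats the real
    and the complex case at once. *)

Lemma norm_comb_le {K : numFieldType} {X : normedModType K} (n : nat)
    (P : pred 'I_n) (lam : 'I_n -> K) (xs : 'I_n -> X) :
  (forall j, 0 < lam j) -> (forall j, unit_ball (xs j)) ->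
  `|\sum_(j < n | P j) lam j *: xs j| <= \sum_(j < n | P j) lam j.
Proof.
move=> lam_gt0 xs1; apply: le_trans (ler_norm_sum _ _ _) _.
apply: ler_sum => j _; rewrite normrZ gtr0_norm//.
by rewrite -[leRHS]mulr1 ler_pM2l//; exact: xs1.
Qed.

(** This is where n >= 2 matters: the complementary weight 1 - lam_j is positive,
    so that the other summands can be normalised to a point of the ball. *)
Lemma extreme_point_comb {K : numFieldType} {X : normedModType K} (x : X)
    (n : nat) (xs : 'I_n -> X) (lam : 'I_n -> K) :
  extreme_point (@unit_ball K X) x -> (2 <= n)%N ->
  (forall j, unit_ball (xs j)) -> (forall j, 0 < lam j) ->
  \sum_(j < n) lam j = 1 -> x = \sum_(j < n) lam j *: xs j ->
  forall j, xs j = x.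
Proof.
move=> [_ xext] n2 xs1 lam_gt0 lam1 xE j.
have compl_lam : \sum_(i < n | i != j) lam i = 1 - lam j.
  by rewrite -lam1 [in RHS](bigD1 j)//= [in RHS]addrC addrK.
have [i ij] : exists i : 'I_n, i != j.
  by apply/(@card_gt0P _ (predC1 j)); rewrite cardC1 card_ord -subn1 subn_gt0.
have compl_gt0 : 0 < 1 - lam j.
  rewrite -compl_lam (bigD1 i)//= ltr_wpDr ?lam_gt0// sumr_ge0// => k _.
  exact: ltW.
pose z := (1 - lam j)^-1 *: \sum_(i < n | i != j) lam i *: xs i.
have z1 : unit_ball z.
  rewrite /unit_ball /z /= normrZ gtr0_norm ?invr_gt0// ler_pdivrMl// mulr1.
  by rewrite -compl_lam; exact: norm_comb_le.
have xjz : x = lam j *: xs j + (1 - lam j) *: z.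
  by rewrite /z scalerA divff ?gt_eqF// scale1r xE (bigD1 j).
have lam_lt1 : lam j < 1 by rewrite -subr_gt0.
by have [] := xext _ _ _ (xs1 j) z1 (lam_gt0 j) lam_lt1 xjz.
Qed.

Lemma has_co_at_extreme {K : numFieldType} {X : normedModType K} (x : X) :
  extreme_point (@unit_ball K X) x -> has_co_at x.
Proof.
move=> xext n xs lam n2 xs1 lam_gt0 lam1 xE e e0; exists e => //=.
have xsE := extreme_point_comb _ _ _ _ xext n2 xs1 lam_gt0 lam1 xE.
exists (fun _ => id); split => [j|u [xu u1]].
  by apply: continuous_subspaceT => u; exact: cvg_id.
split; first by rewrite -scaler_suml lam1 scale1r.
move=> j; split=> //; rewrite xsE distrC.
by move: xu; rewrite -ball_normE.
Qed.

Lemma has_co_at_interior {K : numFieldType} {X : normedModType K} (x : X) :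
  `|x| < 1 -> has_co_at x.
Proof.
move=> x1 n xs lam n2 xs1 lam_gt0 lam1 xE e e0.
(* The j-th point will be moved by at most t |x - x_j| + |u - x| <= 2 t + t.
   This t satisfies both t < 1 and 4 t < e, without taking a minimum in the
   partially ordered K. *)
pose t := e / (4 + e).
have e4 : 0 < 4 + e by rewrite addr_gt0.
have t0 : 0 < t by rewrite divr_gt0.
have t1 : t < 1 by rewrite ltr_pdivrMr// mul1r ltrDr.
have t4 : t * 4 < e.
  by rewrite mulrAC ltr_pdivrMr// ltr_pM2l// ltrDl.
have x1' : 0 < 1 - `|x| by rewrite subr_gt0.
exists (t * (1 - `|x|)); first by rewrite mulr_gt0.
exists (fun j u => ((1 - t) *: xs j + t *: x) + (u - x)); split=> [j|u [xu u1]].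
  apply: continuous_subspaceT => u.
  by apply: cvgD; [exact: cvg_cst|apply: cvgB; [exact: cvg_id|exact: cvg_cst]].
have {}xu : `|u - x| < t * (1 - `|x|).
  by move: xu; rewrite -ball_normE /= distrC.
split.
  under eq_bigr do rewrite 2!scalerDr.
  rewrite !big_split/= -!scaler_suml.
  under eq_bigr do rewrite scalerA mulrC -scalerA.
  rewrite -scaler_sumr -xE lam1 !scale1r.
  by rewrite -scalerDl subrK scale1r addrC subrK.
move=> j; split.
  rewrite /unit_ball/=; apply: le_trans (ler_normD _ _) _.
  rewrite [leRHS](_ : 1 = ((1 - t) + t * `|x|) + t * (1 - `|x|)); last first.
    by rewrite -addrA -mulrDr [`|x| + _]addrC subrK mulr1 subrK.
  apply: lerD; last exact: ltW.
  apply: le_trans (ler_normD _ _) _; rewrite 2!normrZ (gtr0_norm t0).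
  rewrite gtr0_norm ?subr_gt0// lerD2r -[leRHS]mulr1 ler_pM2l ?subr_gt0//.
  exact: xs1.
have -> : (1 - t) *: xs j + t *: x + (u - x) - xs j = t *: (x - xs j) + (u - x).
  rewrite scalerBl scale1r scalerBr addrAC; congr (_ + _).
  by rewrite addrAC [_ - t *: _ - _]addrAC subrr sub0r addrC.
apply: le_lt_trans (ler_normD _ _) _; rewrite normrZ (gtr0_norm t0).
have xxj : `|x - xs j| <= 1 + 1.
  by apply: le_trans (ler_normB _ _) (lerD (ltW x1) (xs1 j)).
apply: lt_trans t4; have -> : t * 4 = t * (1 + 1) + t * (1 + 1).
  by rewrite -mulrDr -[4%N]/(2 + 2)%N natrD.
apply: ler_ltD; first by rewrite ler_pM2l.
apply: lt_le_trans xu _; rewrite ler_pM2l// lerD2l.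
by apply: (@le_trans _ _ 0); rewrite ?oppr_le0.
Qed.

(** When t <= 1/2 the point t y + (1 - t) z lies between z and the midpoint of
    y and z, and the midpoint is the only point about which strict convexity
    says anything. *)
Lemma strictly_convex_comb_lt {K : numFieldType} {X : normedModType K}
    (y z : X) (t : K) :
  `|2^-1 *: (y + z)| < 1 -> unit_ball z -> 0 < t -> t <= 2^-1 ->
  `|t *: y + (1 - t) *: z| < 1.
Proof.
move=> yz z1 t0 t2.
have t2' : 0 <= 1 - t * 2 by rewrite subr_ge0 -ler_pdivlMr// mul1r.
have -> : t *: y + (1 - t) *: z
    = (t * 2) *: (2^-1 *: (y + z)) + (1 - t * 2) *: z.
  rewrite scalerA mulfK ?pnatr_eq0// scalerDr -addrA -scalerDl.
  by congr (_ + _ *: _); rewrite mulr_natr mulr2n opprD addrCA addNKr.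
apply: le_lt_trans (ler_normD _ _) _.
rewrite (normrZ (t * 2)) (normrZ (1 - t * 2)).
have t20 : 0 < t * 2 by rewrite mulr_gt0.
rewrite (gtr0_norm t20) (ger0_norm t2').
rewrite [ltRHS](_ : 1 = t * 2 + (1 - t * 2)); last by rewrite addrC subrK.
apply: ltr_leD; first by rewrite -[ltRHS]mulr1 ltr_pM2l.
by rewrite -[leRHS]mulr1 ler_wpM2l.
Qed.

(** The end points of a segment of the ball through a unit vector x, with x
    strictly inside, are unit vectors too; if they were distinct, strict
    convexity would push x into the open ball. *)
Lemma strictly_convex_extreme {K : numFieldType} {X : normedModType K} (x : X) :
  strictly_convex X -> `|x| = 1 -> extreme_point (@unit_ball K X) x.
Proof.
move=> sc x1; split; first by rewrite /unit_ball/= x1.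
move=> y z t y1 z1 t0 t1 xE.
have t1' : 0 < 1 - t by rewrite subr_gt0.
have xE' : x = (1 - t) *: z + (1 - (1 - t)) *: y by rewrite subKr addrC.
have norm1 (a b : X) (s : K) : unit_ball a -> unit_ball b -> 0 < s ->
    0 < 1 - s -> x = s *: a + (1 - s) *: b -> `|a| = 1.
  move=> a1 b1 s0 s1 xab; apply/eqP/negPn/negP => aN1.
  suff : `|x| < 1 by rewrite x1 ltxx.
  rewrite xab; apply: le_lt_trans (ler_normD _ _) _; rewrite 2!normrZ !gtr0_norm//.
  rewrite [ltRHS](_ : 1 = s + (1 - s)); last by rewrite addrC subrK.
  apply: ltr_leD; first by rewrite -[ltRHS]mulr1 ltr_pM2l// lt_neqAle aN1.
  by rewrite -[leRHS]mulr1 ler_pM2l.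
have y1E : `|y| = 1 by apply: norm1 xE.
have z1E : `|z| = 1 by apply: norm1 xE' => //; rewrite subKr.
suff yz : y = z by rewrite xE yz -scalerDl addrC subrK scale1r.
apply/eqP/negPn/negP => /eqP yz.
suff : `|x| < 1 by rewrite x1 ltxx.
have half_gt0 : 0 < 2^-1 :> K by rewrite invr_gt0.
(* One of the weights t and 1 - t is at most 1/2. *)
have [t2|/ltW t2] := real_leP (gtr0_real t0) (gtr0_real half_gt0).
- by rewrite xE; apply: strictly_convex_comb_lt => //; exact: sc.
- rewrite xE'; apply: strictly_convex_comb_lt => //.
    by rewrite addrC; exact: sc.
  by rewrite lerBlDr -lerBlDl {1}(splitr 1) mul1r addrK.
Qed.

Theorem proposition2p3 (R : realType) (K : numFieldType)
    (hK : real_or_complex R K) (X : completeNormedModType K) :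
  (forall x : X, unit_ball x ->
     extreme_point (@unit_ball K X) x \/ `|x| < 1 -> has_co_at x) /\
  (strictly_convex X -> has_co X).
Proof.
have co_at (x : X) :
    extreme_point (@unit_ball K X) x \/ `|x| < 1 -> has_co_at x.
  by case=> [/has_co_at_extreme|/has_co_at_interior].
split=> [x _|sc x x1]; first exact: co_at.
have [x1E|x1N] := eqVneq `|x| 1; apply: co_at.
  by left; exact: strictly_convex_extreme.
by right; rewrite lt_neqAle x1N.
Qed.
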